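(* Let $Q$ be an acyclic quiver with three vertices. Then the set $\mathrm{green}(Q)$ of maximal green sequences for $Q$ is finite and non-empty.
   Context: Quivers are finite oriented graphs (multiple arrows allowed), connected unless specified otherwise; $Q_0$ is the set of vertices and $Q_1$ the set of arrows. A quiver is acyclic if it has no oriented cycles. A cluster quiver is a quiver without loops or oriented 2-cycles. An ice quiver is a pair $(Q,F)$ with $Q$ a cluster quiver and $F\subset Q_0$ a (possibly empty) set of frozen vertices with no arrows between them. Mutation at a non-frozen vertex $k$: $\mu_k(Q)$ is obtained from $Q$ by (1) adding an arrow $i\to j$ for each pair of arrows $i\to k\to j$; (2) reversing all arrows incident to $k$; (3) removing a maximal collection of 2-cycles and all arrows between frozen vertices. Two ice quivers are mutation-equivalent if one is obtained from the other by finitely many successive mutations at non-frozen vertices. The framed quiver $\widehat Q$ of a cluster quiver $Q$ has vertices $Q_0\sqcup\{i' : i\in Q_0\}$ and arrows $Q_1\sqcup\{i\to i' : i\in Q_0\}$; it is an ice quiver with frozen vertices $Q_0'=\{i' : i\in Q_0\}$. For $R$ mutation-equivalent to $\widehat Q$, a non-frozen vertex $i$ is green in $R$ if there is no arrow $j'\to i$ in $R$ with $j'\in Q_0'$, and red if there is no arrow $i\to j'$ in $R$ with $j'\in Q_0'$. (It is known that every non-frozen vertex is either green or red.) A green sequence for $Q$ is a sequence $(i_1,\dots,i_l)$ in $Q_0$ such that $i_1$ is green in $\widehat Q$ and $i_k$ is green in $\mu_{i_{k-1}}\circ\cdots\circ\mu_{i_1}(\widehat Q)$ for $2\le k\le l$.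 It is maximal if every non-frozen vertex of $\mu_{i_l}\circ\cdots\circ\mu_{i_1}(\widehat Q)$ is red. $\mathrm{green}(Q)$ denotes the set of all maximal green sequences for $Q$. *)

(* Defs.v *)
From mathcomp Require Import all_boot.
From mathcomp Require Import boolp classical_sets cardinality.

Set Implicit Arguments.
Unset Strict Implicit.
Unset Printing Implicit Defensive.

Local Open Scope classical_set_scope.

(* A finite quiver with vertex set [V], up to renaming of its arrows:
   [Q i j] is the number of arrows i -> j. *)
Definition quiver (V : finType) := V -> V -> nat.

Section Quivers.
Variable V : finType.
Implicit Types (Q : quiver V) (F : {set V}).

Definition arrow Q : rel V := fun i j => 0 < Q i j.

Definition connected_quiver Q : Prop :=
  0 < #|V| /\
  forall i j, connect (fun x y => arrow Q x y || arrow Q y x) i j.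

Definition acyclic Q : Prop :=
  forall c : seq V, c != [::] -> ~~ cycle (arrow Q) c.

Definition cluster_quiver Q : Prop :=
  (forall i, ~~ arrow Q i i) /\ (forall i j, ~~ (arrow Q i j && arrow Q j i)).

Definition ice_quiver Q F : Prop :=
  cluster_quiver Q /\ {in F &, forall i j, ~~ arrow Q i j}.

Definition compose_at k Q : quiver V := fun i j => Q i j + Q i k * Q k j.

Definition reverse_at k Q : quiver V :=
  fun i j => if (i == k) || (j == k) then Q j i else Q i j.

(* A maximal collection of 2-cycles between i and j has
   [minn (Q i j) (Q j i)] elements, so [Q i j - Q j i] (truncated) arrows
   i -> j remain. *)
Definition cancel_2cycles F Q : quiver V :=
  fun i j => if (i \in F) && (j \in F) then 0 else Q i j - Q j i.

Definition mutation F k Q : quiver V :=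
  cancel_2cycles F (reverse_at k (compose_at k Q)).

End Quivers.

Section Green.
Variable V : finType.
Implicit Types (Q : quiver V) (R : quiver (V + V)%type) (s : seq V).

(* In [V + V], [inl i] is the vertex i and [inr i] its frozen copy i'. *)
Definition framed Q : quiver (V + V)%type := fun x y =>
  match x, y with
  | inl i, inl j => Q i j
  | inl i, inr j => nat_of_bool (i == j)
  | inr _, _ => 0
  end.

Definition frozen_copy : {set V + V} := [set x | ~~ is_inl x].

Definition mutations Q s : quiver (V + V)%type :=
  foldl (fun R i => mutation frozen_copy (inl i) R) (framed Q) s.

Definition green R (i : V) : Prop := forall j, ~~ arrow R (inr j) (inl i).

Definition red R (i : V) : Prop := forall j, ~~ arrow R (inl i) (inr j).

Definition green_sequence Q s : Prop :=
  forall s1 i s2, s = s1 ++ i :: s2 -> green (mutations Q s1) i.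

Definition maximal_green_sequence Q s : Prop :=
  green_sequence Q s /\ forall i, red (mutations Q s) i.

Definition maximal_green_sequences Q : set (seq V) :=
  [set s | maximal_green_sequence Q s].

End Green.

Lemma acyclic_cluster_quiver (V : finType) (Q : quiver V) :
  acyclic Q -> cluster_quiver Q.
Proof.
move=> acQ; split=> [i|i j].
  by have := acQ [:: i] isT; rewrite /= andbT.
by have := acQ [:: i; j] isT; rewrite /= andbT.
Qed.

Lemma framed_ice_quiver (V : finType) (Q : quiver V) :
  cluster_quiver Q -> ice_quiver (framed Q) (frozen_copy V).
Proof.
move=> [noloop no2]; split; last by move=> [i|i] [j|j]; rewrite !inE.
split=> [[i|i]|[i|i] [j|j]] //=; [exact: noloop | exact: no2 |].
by rewrite /arrow /= andbF.
Qed.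

(* The result of the three mutation steps never has loops or 2-cycles. *)
Lemma mutation_ice_quiver (V : finType) (F : {set V}) (k : V) (Q : quiver V) :
  ice_quiver (mutation F k Q) F.
Proof.
rewrite /mutation; move: (reverse_at _ _) => P.
rewrite /ice_quiver /cluster_quiver /arrow /cancel_2cycles.
split; last by move=> i j -> ->.
split=> [i|i j]; first by case: ifP => // _; rewrite subnn.
rewrite andbC [(i \in F) && _]andbC; case: ifP => // _.
by rewrite !subn_gt0; apply/negP => /andP[h1 /ltnW]; rewrite leqNgt h1.
Qed.

(* Main.v *)
From Stdlib Require Import ZArith Lia.
Require Import Defs.
From mathcomp Require Import all_boot.
From mathcomp Require Import boolp classical_sets cardinality.
Local Open Scope classical_set_scope.

(** Mutating the three vertices in an order where every arrow goes forward
  always meets a green source, reverses its arrows and leaves the other vertices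
  untouched; all vertices end up red. This is a maximal green sequence.

  For finiteness, the length of a maximal green sequence is bounded by 7,
  whatever the multiplicities of Q. A quiver reached from the framed quiver is
  recorded by the signed numbers of arrows between its three vertices and by its
  c-vectors, the signed numbers of arrows from each vertex to the frozen ones
  (record [triangle]). The c-vectors stay linearly independent, so none of them
  vanishes and no vertex is both green and red.

  The key phenomenon is that a double arrow can trap a green sequence. Suppose
  that r is red, that p is green, that there are m >= 2 arrows r -> p, and that
  the c-vector of p dominates the opposite of that of r. Mutating p turns c_r
  into c_r + m c_p, which dominates c_p again: p and r have exchanged their
  roles. As long as the third vertex q does not interfere, some vertex stays
  green for ever. Conditions on the multiplicities that prevent q from
  interfering are given by [red_trap_dead] when q is red and by
  [green_trap_dead] when q is green.

  Another kind of trap, [belt_dead] and [tree_belt_dead], consists of the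
  sequences that run through acyclic quivers for ever by mutating sinks, with
  growing c-vectors; leaving this regime leads back to it or into one of the
  first two traps.

  It remains to follow the green sequences of an acyclic quiver x -> y -> z,
  x -> z until they stop or are trapped, according to the vertex mutated first
  ([source_first], [middle_first], [sink_first]). This is a finite exploration,
  because it depends on a multiplicity only through its being 0, 1 or larger. *)

Set Implicit Arguments.
Unset Strict Implicit.
Unset Printing Implicit Defensive.

Section Framed.
Variable V : finType.
Implicit Types (R : quiver (V + V)%type) (s : seq V).

Local Notation mu k R := (mutation (frozen_copy V) (inl k) R).

(** * Green sequences from an arbitrary quiver *)

Fixpoint completes R s : Prop :=
  if s is k :: s' then green R k /\ completes (mu k R) s' else forall i, red R i.

Lemma maximal_green_sequenceP (Q : quiver V) s :
  maximal_green_sequence Q s <-> completes (framed Q) s.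
Proof.
rewrite /maximal_green_sequence /green_sequence /mutations.
elim: s (framed Q) => [|k s IH] R /=.
  by split=> [[]|redR] //; split=> // -[|? ?].
split=> [[grn fin]|[grn /IH[grns fin]]].
  split; first exact: (grn [::] k s).
  apply/IH; split=> // s1 i s2 def_s.
  by apply: (grn (k :: s1) i s2); rewrite def_s.
split=> // -[|i s1] j s2 [eq_k eq_s]; first by rewrite -eq_k.
by rewrite -eq_k; apply: (grns s1 j s2 eq_s).
Qed.

Definition bounded n R := forall s, completes R s -> size s <= n.

Definition dead R := forall s, ~ completes R s.

Lemma bounded_dead n R : dead R -> bounded n R.
Proof. by move=> deadR s /deadR. Qed.

Lemma bounded_weaken m n R : m <= n -> bounded m R -> bounded n R.
Proof. by move=> lemn bR s /bR /leq_trans; apply. Qed.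

Local Open Scope Z_scope.

(** * Signed arrow counts under mutation *)

Definition net R (i j : V + V) : Z := Z.of_nat (R i j) - Z.of_nat (R j i).

Lemma net_opp R i j : net R i j = - net R j i.
Proof. by rewrite /net; lia. Qed.

Lemma net_mutation_at R k i : cluster_quiver R ->
  net (mu k R) (inl k) i = - net R (inl k) i.
Proof.
move=> [noloop _]; have Rkk : R (inl k) (inl k) = 0%N.
  by apply/eqP; rewrite -leqn0 leqNgt; apply: noloop.
rewrite /net /mutation /cancel_2cycles /reverse_at /compose_at !inE /= andbF.
by rewrite !eqxx orbT /= Rkk mul0n muln0 !addn0 -!minusE; lia.
Qed.

Lemma arrow_net R i j : cluster_quiver R -> Z.of_nat (R i j) = Z.max (net R i j) 0.
Proof.
move=> [_ /(_ i j)]; rewrite /arrow /net.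
by case: (R i j) (R j i) => [|m] [|n] //= _; lia.
Qed.

Lemma net_mutation R k i j : cluster_quiver R -> i != k -> j != inl k ->
  net (mu k R) (inl i) j = net R (inl i) j +
    (Z.max (net R (inl i) (inl k)) 0 * Z.max (net R (inl k) j) 0
     - Z.max (net R j (inl k)) 0 * Z.max (net R (inl k) (inl i)) 0).
Proof.
move=> clR ik jk; have {}ik: inl i != inl k :> V + V by [].
rewrite -(arrow_net (inl i) (inl k) clR) -(arrow_net (inl k) j clR).
rewrite -(arrow_net j (inl k) clR) -(arrow_net (inl k) (inl i) clR).
rewrite /net /mutation /cancel_2cycles /reverse_at /compose_at !inE /= andbF.
rewrite (negPf ik) (negPf jk) /= -!minusE -!plusE -!multE; lia.
Qed.

Lemma green_net R i : cluster_quiver R ->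
  green R i <-> forall j, 0 <= net R (inl i) (inr j).
Proof.
move=> clR; split=> + j => /(_ j); rewrite /arrow.
  by rewrite -leqNgt leqn0 => /eqP; rewrite /net => ->; lia.
move=> pos; apply/negP => lt0.
have := arrow_net (inr j) (inl i) clR; move/ltP: lt0; rewrite /net in pos *; lia.
Qed.

Lemma red_net R i : cluster_quiver R ->
  red R i <-> forall j, net R (inl i) (inr j) <= 0.
Proof.
move=> clR; split=> + j => /(_ j); rewrite /arrow.
  by rewrite -leqNgt leqn0 => /eqP; rewrite /net => ->; lia.
move=> neg; apply/negP => lt0.
have := arrow_net (inl i) (inr j) clR; move/ltP: lt0; rewrite /net in neg *; lia.
Qed.

(** * The exchange data of a quiver with three mutable vertices *)

(** The weights are taken along the cycle x -> y -> z -> x, so that rotating the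
  vertices rotates the weights and no vertex is distinguished: a cyclic quiver
  has three weights of the same sign. The last field says that the c-vectors are
  linearly independent. *)
Record triangle R (x y z : V) (a b c : Z) (u v w : V -> Z) : Prop := Triangle {
  tri_uniq : uniq [:: x; y; z];
  tri_all : forall k, k \in [:: x; y; z];
  tri_cluster : cluster_quiver R;
  tri_xy : net R (inl x) (inl y) = a;
  tri_yz : net R (inl y) (inl z) = b;
  tri_zx : net R (inl z) (inl x) = c;
  tri_u : forall j, net R (inl x) (inr j) = u j;
  tri_v : forall j, net R (inl y) (inr j) = v j;
  tri_w : forall j, net R (inl z) (inr j) = w j;
  tri_free : forall l m n, (forall j, l * u j + m * v j + n * w j = 0) ->
    [/\ l = 0, m = 0 & n = 0] }.

Lemma tri_rot R x y z a b c u v w :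
  triangle R x y z a b c u v w -> triangle R y z x b c a v w u.
Proof.
case=> Ruq all clR xy yz zx Ru Rv Rw free; split=> //.
- by rewrite -(rot_uniq 1) in Ruq.
- by move=> k; rewrite -(mem_rot 2); apply: all.
- move=> l m n eq0; have [|-> -> ->] // := free n l m.
  by move=> j; rewrite -[RHS](eq0 j); lia.
Qed.

Lemma tri_swap R x y z a b c u v w :
  triangle R x y z a b c u v w -> triangle R x z y (- c) (- b) (- a) u w v.
Proof.
have pe : perm_eq [:: x; z; y] [:: x; y; z].
  by rewrite perm_cons (perm_catC [:: z] [:: y]).
case=> Ruq all clR xy yz zx Ru Rv Rw free; split=> //.
- by rewrite (perm_uniq pe).
- by move=> k; rewrite (perm_mem pe).
- by rewrite net_opp zx.
- by rewrite net_opp yz.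
- by rewrite net_opp xy.
- move=> l m n eq0; have [|-> -> ->] // := free l n m.
  by move=> j; rewrite -[RHS](eq0 j); lia.
Qed.

Definition pos (u : V -> Z) := (forall j, 0 <= u j) /\ exists j, 0 < u j.

Lemma pos_not_neg u : pos u -> ~ forall j, u j <= 0.
Proof. by case=> _ [j uj] /(_ j); lia. Qed.

(** This is where independence is used: greenness alone would allow a vanishing
  c-vector. *)
Lemma tri_pos R x y z a b c u v w : triangle R x y z a b c u v w ->
  (forall j, 0 <= u j) -> pos u.
Proof.
move=> T u0; split=> //; apply: contrapT => /forallNP upos.
have [|//] := tri_free T (l := 1) (m := 0) (n := 0).
by move=> j; have := u0 j; have := upos j; lia.
Qed.

Lemma tri_mut R x y z a b c u v w : triangle R x y z a b c u v w ->
  (forall j, 0 <= u j) ->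
  triangle (mu x R) x y z (- a)
    (b + (Z.max (- a) 0 * Z.max (- c) 0 - Z.max c 0 * Z.max a 0)) (- c)
    (fun j => - u j) (fun j => v j + Z.max (- a) 0 * u j)
    (fun j => w j + Z.max c 0 * u j).
Proof.
case=> Ruq all clR xy yz zx Ru Rv Rw free u0.
have [yx zx'] : y != x /\ z != x.
  by move: Ruq; rewrite /= !inE negb_or !(eq_sym x) => /andP[/andP[]].
have inl_neq (i : V) : i != x -> inl i != inl x :> V + V by [].
split=> //.
- by case: (mutation_ice_quiver (frozen_copy V) (inl x) R).
- by rewrite net_mutation_at // xy.
- rewrite (net_mutation clR yx (inl_neq z zx')) yz xy zx.
  by rewrite (net_opp _ (inl y) (inl x)) (net_opp _ (inl x) (inl z)) xy zx.
- by rewrite net_opp net_mutation_at // (net_opp R) zx; lia.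
- by move=> j; rewrite net_mutation_at // Ru.
- move=> j; rewrite (net_mutation clR yx) // Rv xy Ru.
  rewrite (net_opp _ (inl y) (inl x)) (net_opp _ (inr j)) xy Ru.
  by rewrite (Z.max_l (u j)) // (Z.max_r (- u j)); have := u0 j; lia.
- move=> j; rewrite (net_mutation clR zx') // Rw zx Ru.
  rewrite (net_opp _ (inl x) (inl z)) (net_opp _ (inr j)) zx Ru.
  by rewrite (Z.max_l (u j)) // (Z.max_r (- u j)); have := u0 j; lia.
- move=> l m n eq0.
  have [j|l0 m0 n0] :=
    free (- l + m * Z.max (- a) 0 + n * Z.max c 0) m n.
    by rewrite -[RHS](eq0 j); ring.
  by subst; split=> //; lia.
Qed.

Lemma tri_eq R x y z a b c u v w a' b' c' u' v' w' :
  triangle R x y z a b c u v w -> a = a' -> b = b' -> c = c' ->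
  u =1 u' -> v =1 v' -> w =1 w' -> triangle R x y z a' b' c' u' v' w'.
Proof.
by move=> T <- <- <- /funext<- /funext<- /funext<-.
Qed.

(** The four ways a vertex can sit between its two neighbours give [tri_mut]
  without maxima; the fourth one, y -> x -> z, is [tri_mut_through] after
  swapping y and z. *)
Lemma tri_mut_source R x y z a b c u v w : triangle R x y z a b c u v w ->
  0 <= a -> c <= 0 -> (forall j, 0 <= u j) ->
  triangle (mu x R) x y z (- a) b (- c) (fun j => - u j) v w.
Proof.
move=> T a0 c0 u0; have := tri_mut T u0.
have [-> ->] : Z.max a 0 = a /\ Z.max (- a) 0 = 0 by lia.
have [-> ->] : Z.max c 0 = 0 /\ Z.max (- c) 0 = - c by lia.
by move/tri_eq; apply=> [||||j|j] //; lia.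
Qed.

Lemma tri_mut_sink R x y z a b c u v w : triangle R x y z a b c u v w ->
  a <= 0 -> 0 <= c -> (forall j, 0 <= u j) ->
  triangle (mu x R) x y z (- a) b (- c)
    (fun j => - u j) (fun j => v j - a * u j) (fun j => w j + c * u j).
Proof.
move=> T a0 c0 u0; have := tri_mut T u0.
have [-> ->] : Z.max a 0 = 0 /\ Z.max (- a) 0 = - a by lia.
have [-> ->] : Z.max c 0 = c /\ Z.max (- c) 0 = 0 by lia.
by move/tri_eq; apply=> [||||j|j] //; lia.
Qed.

Lemma tri_mut_through R x y z a b c u v w : triangle R x y z a b c u v w ->
  0 <= a -> 0 <= c -> (forall j, 0 <= u j) ->
  triangle (mu x R) x y z (- a) (b - a * c) (- c)
    (fun j => - u j) v (fun j => w j + c * u j).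
Proof.
move=> T a0 c0 u0; have := tri_mut T u0.
have [-> ->] : Z.max a 0 = a /\ Z.max (- a) 0 = 0 by lia.
have [-> ->] : Z.max c 0 = c /\ Z.max (- c) 0 = 0 by lia.
by move/tri_eq; apply=> [||||j|j] //; lia.
Qed.

Lemma tri_greenP R x y z a b c u v w :
  triangle R x y z a b c u v w -> green R x <-> forall j, 0 <= u j.
Proof.
move=> T; rewrite (green_net _ (tri_cluster T)).
by split=> u0 j; move: (u0 j); rewrite (tri_u T).
Qed.

Lemma tri_redP R x y z a b c u v w :
  triangle R x y z a b c u v w -> red R x <-> forall j, u j <= 0.
Proof.
move=> T; rewrite (red_net _ (tri_cluster T)).
by split=> u0 j; move: (u0 j); rewrite (tri_u T).
Qed.

Lemma tri_green R x y z a b c u v w :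
  triangle R x y z a b c u v w -> green R x -> pos u.
Proof. by move=> T /(tri_greenP T); apply: tri_pos T. Qed.

(** The end of a sequence, where all vertices are red, is reached by a step
  without successor: it also takes one unit of the bound. *)
Lemma bounded_step n R x y z a b c u v w :
    triangle R x y z a b c u v w ->
    (pos u -> bounded n (mu x R)) -> (pos v -> bounded n (mu y R)) ->
    (pos w -> bounded n (mu z R)) ->
  bounded n.+1 R.
Proof.
move=> T bx by_ bz [//|k s] /= [grk cs].
have := tri_all T k; rewrite !inE => /or3P[] /eqP eqk; rewrite eqk in grk cs.
- by apply: bx cs; apply: tri_green T grk.
- by apply: by_ cs; apply: tri_green (tri_rot T) grk.
- by apply: bz cs; apply: tri_green (tri_rot (tri_rot T)) grk.
Qed.

(** * Traps *)

(** The vertices are quantified existentially, so that a trap need not say how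
  they exchange their roles along a sequence. *)
Definition confined (P : Z -> Z -> Z -> (V -> Z) -> (V -> Z) -> (V -> Z) -> Prop)
    R :=
  exists x y z a b c u v w, triangle R x y z a b c u v w /\ P a b c u v w.

(** A property of the exchange data that forces a green vertex and survives every
  green mutation (up to falling into a trap already known) is a trap. *)
Lemma dead_confined P :
    (forall R x y z a b c u v w,
       triangle R x y z a b c u v w -> P a b c u v w ->
     [/\ [\/ pos u, pos v | pos w],
         pos u -> dead (mu x R) \/ confined P (mu x R),
         pos v -> dead (mu y R) \/ confined P (mu y R) &
         pos w -> dead (mu z R) \/ confined P (mu z R)]) ->
  forall R, confined P R -> dead R.
Proof.
move=> stepP R PR s; elim: s R PR => [|k s IH] R.
  case=> [x [y [z [a [b [c [u [v [w [T /(stepP _ _ _ _ _ _ _ _ _ _ T)]]]]]]]]]].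
  case=> [gt0 _ _ _] /= redR; case: gt0 => /pos_not_neg; apply.
  - exact/(tri_redP T)/redR.
  - exact/(tri_redP (tri_rot T))/redR.
  - exact/(tri_redP (tri_rot (tri_rot T)))/redR.
case=> [x [y [z [a [b [c [u [v [w [T /(stepP _ _ _ _ _ _ _ _ _ _ T)]]]]]]]]]].
case=> _ sx sy sz [grk cs].
have {IH}next R' : dead R' \/ confined P R' -> ~ completes R' s.
  by case=> [|/IH]; apply.
have := tri_all T k; rewrite !inE => /or3P[] /eqP eqk; rewrite eqk in grk cs.
- by apply: next cs; apply/sx/(tri_green T grk).
- by apply: next cs; apply/sy/(tri_green (tri_rot T) grk).
- by apply: next cs; apply/sz/(tri_green (tri_rot (tri_rot T)) grk).
Qed.

Ltac pointwise :=
  let j := fresh "j" in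
  intro j; repeat match goal with
    H : forall i : Finite.sort V, @?P i |- _ => specialize (H j) end.

Ltac refute_red := case/pos_not_neg; pointwise; lia.

(** The vertices r, p, q carry the c-vectors u, v, w, and m, s, t count, with
  signs, the arrows r -> p, p -> q, q -> r. As q is red and has no arrow to p,
  mutating p, the only choice, does not affect it; then (p, r, q) is in the same
  situation with weights m, m s - t, s, and m >= 2 makes them nondecreasing. *)
Definition red_trap (m s t : Z) (u v w : V -> Z) : Prop :=
  [/\ 2 <= m, 0 <= s, t <= s, forall j, u j <= 0 /\ w j <= 0 &
      forall j, - u j <= v j].

Lemma red_trap_dead R : confined red_trap R -> dead R.
Proof.
apply: dead_confined => {}R r p q m s t u v w T [m2 s0 ts uw0 uv].
split.
- by apply/Or32/(tri_pos (tri_rot T)); pointwise; lia.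
- by refute_red.
- case=> v0 _; right.
  have T' := tri_swap (tri_mut_through (tri_rot T) s0 ltac:(lia) v0).
  do 9 eexists; split; first exact: T'.
  by split; [lia | nia | nia | pointwise; lia | pointwise; nia].
- by refute_red.
Qed.

(** Now q may be mutated, but only once: it then becomes red and dominated by p,
  and (q, p, r) is a red trap with weights s, s t - m, t. Hence the last
  inequality on the weights, which mutations at p preserve. *)
Definition green_trap (m s t : Z) (u v w : V -> Z) : Prop :=
  [/\ 2 <= m, 2 <= s, 0 < t <= s /\ t <= s * t - m, forall j, u j <= 0 <= w j &
      forall j, - u j <= v j].

Lemma green_trap_dead R : confined green_trap R -> dead R.
Proof.
apply: dead_confined => {}R r p q m s t u v w T [m2 s2 [ts mst] uw0 uv].
split.
- by apply/Or32/(tri_pos (tri_rot T)); pointwise; lia.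
- by refute_red.
- case=> v0 _; right.
  have T' := tri_swap (tri_mut_through (tri_rot T) ltac:(lia) ltac:(lia) v0).
  do 9 eexists; split; first exact: T'.
  by split; [lia | nia | nia | pointwise; lia | pointwise; nia].
- case=> w0 _; left; apply: red_trap_dead.
  have T' := tri_swap (tri_mut_through (tri_rot (tri_rot T))
               ltac:(lia) ltac:(lia) w0).
  do 9 eexists; split; first exact: T'.
  by split; [lia | nia | nia | pointwise; lia | pointwise; nia].
Qed.

(** An acyclic quiver x -> y -> z, x -> z whose source x has just been mutated.
  Mutating the sink z gives z -> x -> y, z -> y with the same properties.
  Mutating y creates an oriented cycle and turns the c-vector of x into u + a v.
  The final alternative decides the colour of x at that point: it is green if
  a >= 2, which makes a green trap, and red if a = 1, which makes a red one. *)
Definition belt (a b c : Z) (u v w : V -> Z) : Prop :=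
  [/\ 1 <= a, 1 <= b, c <= -1, forall j, u j <= 0 <= v j &
   (forall j, - u j <= w j) /\
   ((2 <= a /\ forall j, - u j <= v j) \/ (a = 1 /\ forall j, v j <= - u j))].

Lemma belt_dead R : confined belt R -> dead R.
Proof.
apply: dead_confined => {}R x y z a b c u v w T [a1 b1 c1 uv0 [uw uv]].
split.
- by apply/Or32/(tri_pos (tri_rot T)); pointwise; lia.
- by refute_red.
- case=> v0 _; left.
  have T' := tri_mut_through (tri_rot T) ltac:(lia) ltac:(lia) v0.
  case: uv => [] [a2 uv].
    apply: green_trap_dead; have {}T' := tri_swap T'.
    do 9 eexists; split; first exact: T'.
    split; [lia | nia | idtac | pointwise; nia | pointwise; nia].
    (* b * (a b - c) - a - b is the sum of these two products. *)
    have h1: 0 <= a * ((b - 1) * (b + 1)) by apply: Z.mul_nonneg_nonneg; nia.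
    have h2 : 0 <= (- c - 1) * b by nia.
    by split; nia.
  apply: red_trap_dead; have {}T' := tri_swap (tri_rot (tri_rot T')).
  do 9 eexists; split; first exact: T'.
  by split; [lia | nia | nia | pointwise; nia | pointwise; nia].
- case=> w0 _; right.
  have T' := tri_mut_sink (tri_rot (tri_rot T)) ltac:(lia) ltac:(lia) w0.
  do 9 eexists; split; first exact: T'.
  split; [lia | lia | lia | pointwise; nia | split; first by pointwise; nia].
  have [c2|c2] : 2 <= - c \/ - c = 1 by lia.
    by left; split=> //; pointwise; nia.
  by right; split=> //; pointwise; nia.
Qed.

(** The analogue of [belt] for a tree in which x is joined to y by d >= 2 arrows
  and to z by e >= 1 arrows. When e >= 2, mutating sinks leads from x being a
  sink to x being a source, then to a path through x with a red beginning, then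
  to x being a sink again; mutating x in the middle of the path is a green trap.
  When e = 1, mutating z before y leaves x red, hence the alternative in
  [tree_source]; the sequence then goes on through [tree_path_end], a path
  z -> x -> y with y as its only green vertex. And mutating the middle of the
  path y -> x -> z gives the cycle [tree_cycle], from which mutating z leads to
  [tree_path_end] with center z. *)
Definition tree_sink (d e a b c : Z) (u v w : V -> Z) : Prop :=
  [/\ a = - d, b = 0, c = e, forall j, v j <= 0 /\ w j <= 0 &
      forall j, - v j <= u j /\ - w j <= u j].

Definition tree_source (d e a b c : Z) (u v w : V -> Z) : Prop :=
  [/\ a = d, b = 0, c = - e, forall j, u j <= 0 <= w j &
      (forall j, - u j <= v j) /\
      ((2 <= e /\ forall j, - u j <= w j) \/ (e = 1 /\ forall j, w j <= - u j))].

Definition tree_path (d e a b c : Z) (u v w : V -> Z) : Prop :=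
  [/\ a = - d, b = 0, c = - e, forall j, v j <= 0 <= w j &
      forall j, - v j <= u j].

Definition tree_path_end (d e a b c : Z) (u v w : V -> Z) : Prop :=
  [/\ a = d /\ e = 1, b = 0, c = 1, forall j, u j <= 0 /\ w j <= 0 &
      forall j, - u j <= v j /\ - w j <= v j].

Definition tree_cycle (d e a b c : Z) (u v w : V -> Z) : Prop :=
  [/\ a = d /\ e = 1, b = d, c = 1, forall j, u j <= 0 <= w j &
      forall j, - u j <= v j].

Definition tree_belt (a b c : Z) (u v w : V -> Z) : Prop :=
  exists d e, [/\ 2 <= d, 1 <= e &
    tree_sink d e a b c u v w \/ tree_source d e a b c u v w \/
    tree_path d e a b c u v w \/ tree_path_end d e a b c u v w \/
    tree_cycle d e a b c u v w].

Lemma tree_belt_dead R : confined tree_belt R -> dead R.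
Proof.
apply: dead_confined => {}R x y z a b c u v w T [d [e [d2 e1]]].
case=> [|[|[|[|]]]] [].
- move=> ? ? ? vw0 vwu; subst.
  split; [|case=> u0 _; right|by refute_red|by refute_red].
    by apply/Or31/(tri_pos T); pointwise; lia.
  have T' := tri_mut_sink T ltac:(lia) ltac:(lia) u0.
  do 9 eexists; split; first exact: T'.
  exists d, e; split; [lia | lia | right; left].
  split; [lia | lia | lia | pointwise; nia | split; first by pointwise; nia].
  have [e2|e2] : 2 <= e \/ e = 1 by lia.
    by left; split=> //; pointwise; nia.
  by right; split=> //; pointwise; nia.
- move=> ? ? ? uw0 [uv uw]; subst.
  split; [|by refute_red|case=> v0 _; right|case=> w0 _; right].
  + by apply/Or32/(tri_pos (tri_rot T)); pointwise; lia.
  + have T' := tri_rot (tri_rot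
      (tri_mut_sink (tri_rot T) ltac:(lia) ltac:(lia) v0)).
    do 9 eexists; split; first exact: T'.
    exists d, e; split; [lia | lia | right; right; left].
    by split; [lia | lia | lia | pointwise; nia | pointwise; nia].
  + have T' := tri_rot
      (tri_mut_sink (tri_rot (tri_rot T)) ltac:(lia) ltac:(lia) w0).
    case: uw => [] [e2 uw].
      (* The path now begins at z: y and z, hence d and e, are exchanged. *)
      do 9 eexists; split; first exact: tri_swap T'.
      exists e, d; split; [lia | lia | right; right; left].
      by split; [lia | lia | lia | pointwise; nia | pointwise; nia].
    do 9 eexists; split; first exact: T'.
    exists d, e; split; [lia | lia | right; right; right; left].
    by split; [lia | lia | lia | pointwise; nia | pointwise; nia].
- move=> ? ? ? vw0 vu; subst.
  split; [|case=> u0 _|by refute_red|case=> w0 _; right].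
  + by apply/Or31/(tri_pos T); pointwise; lia.
  + have T' := tri_swap
      (tri_mut_through (tri_swap T) ltac:(lia) ltac:(lia) u0).
    have [e2|e2] : 2 <= e \/ e = 1 by lia.
      left; apply: green_trap_dead; do 9 eexists; split; first exact: T'.
      split; [nia | nia | split; first by nia | pointwise; nia | pointwise; nia].
      have h : 0 <= d * (e * e - 2) by apply: Z.mul_nonneg_nonneg; nia.
      by nia.
    right; do 9 eexists; split; first exact: T'.
    exists d, e; split; [lia | lia | right; right; right; right].
    by split; [lia | nia | lia | pointwise; nia | pointwise; nia].
  + have T' := tri_rot
      (tri_mut_sink (tri_rot (tri_rot T)) ltac:(lia) ltac:(lia) w0).
    do 9 eexists; split; first exact: T'.
    exists d, e; split; [lia | lia | left].
    by split; [lia | nia | lia | pointwise; nia | pointwise; nia].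
- case=> ? ? ? ? uw0 uwv; subst.
  split; [|by refute_red|case=> v0 _; right|by refute_red].
    by apply/Or32/(tri_pos (tri_rot T)); pointwise; lia.
  have T' := tri_rot (tri_rot
    (tri_mut_sink (tri_rot T) ltac:(lia) ltac:(lia) v0)).
  do 9 eexists; split; first exact: T'.
  exists d, 1; split; [lia | lia | left].
  by split; [lia | nia | lia | pointwise; nia | pointwise; nia].
- case=> ? ? ? ? uw0 uv; subst.
  split; [|by refute_red|case=> v0 _; left|case=> w0 _; right].
  + by apply/Or32/(tri_pos (tri_rot T)); pointwise; lia.
  + have T' := tri_swap (tri_mut_through (tri_rot T) ltac:(lia) ltac:(lia) v0).
    apply: green_trap_dead; do 9 eexists; split; first exact: T'.
    split; [nia | nia | split; first by nia | pointwise; nia | pointwise; nia].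
    have h : 0 <= d * (d * d - 4) by apply: Z.mul_nonneg_nonneg; nia.
    by nia.
  + have T' := tri_swap
      (tri_mut_through (tri_rot (tri_rot T)) ltac:(lia) ltac:(lia) w0).
    do 9 eexists; split; first exact: T'.
    exists d, 1; split; [lia | lia | right; right; right; left].
    by split; [lia | nia | lia | pointwise; nia | pointwise; nia].
Qed.

(** * Following the green sequences of an acyclic quiver *)

(** Mutation at the first vertex, the signs of the weights deciding how. *)
Ltac mutate_first T pos_first T' :=
  first [ have T' := tri_mut_source T ltac:(lia) ltac:(lia) pos_first
        | have T' := tri_mut_sink T ltac:(lia) ltac:(lia) pos_first
        | have T' := tri_mut_through T ltac:(lia) ltac:(lia) pos_first
        | have T' := tri_swap (tri_mut_through (tri_swap T)
                                 ltac:(lia) ltac:(lia) pos_first) ].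

Ltac refute := case/pos_not_neg; pointwise; nia.

Ltac mutate T :=
  let p := fresh "p" in let T' := fresh "T" in
  case=> p _; mutate_first T p T'; clear p; clear T; rename T' into T.

(** Red vertices are discarded, each of the green ones is mutated, and the
  vertices are put back in their initial order. *)
Ltac step T :=
  apply: (bounded_step T);
  [ first [ refute | mutate T ]
  | first [ refute
          | apply tri_rot in T; mutate T; do 2 apply tri_rot in T ]
  | first [ refute
          | do 2 apply tri_rot in T; mutate T; apply tri_rot in T ] ].

(** For subtrees in which all sequences stop. *)
Ltac explore T := step T; [> explore T ..].

(** T must present the vertices in the order of the roles that they have in the
  trap. *)
Ltac trapped lem T :=
  apply: bounded_dead; apply: lem; do 9 eexists; split; [exact: T|].

Ltac numeric :=
  split; [ nia | nia | try split; nia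
         | pointwise; try split; nia | pointwise; try split; nia ].

(** Once the source x is red, it becomes a sink, and everything happens in the
  Kronecker quiver on y and z: with a double arrow y -> z, the source y has to
  come first. *)
Lemma source_first R x y z a b c u v w :
    triangle R x y z a b c u v w -> 0 <= a -> 0 <= b -> c <= 0 ->
    (forall j, 0 <= u j) -> (forall j, 0 <= v j) -> (forall j, 0 <= w j) ->
  bounded 5 (mu x R).
Proof.
move=> T a0 b0 c0 u0 v0 w0.
have {}T := tri_mut_source T a0 c0 u0.
step T.
  by explore T.
have [b2|b1] : 2 <= b \/ b <= 1 by lia.
  trapped red_trap_dead (tri_rot (tri_swap T)).
  by numeric.
by have [?|?] : b = 0 \/ b = 1; [lia | subst; explore T ..].
Qed.

(** Mutating y gives y -> x, z -> y and c + a b arrows x -> z. This is a trap as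
  soon as x -> y is a double arrow. *)
Lemma middle_first R x y z a b c u v w :
    triangle R x y z a b (- c) u v w -> 0 <= a -> 0 <= b -> 0 <= c ->
    1 <= a + b -> 1 <= a + c -> 1 <= b + c ->
    (forall j, 0 <= u j) -> (forall j, 0 <= v j) -> (forall j, 0 <= w j) ->
  bounded 6 (mu y R).
Proof.
move=> T a0 b0 c0 ab ac bc u0 v0 w0.
have {}T := tri_rot (tri_rot (tri_mut_through (tri_rot T) b0 a0 v0)).
have [a2|[a1|a00]] : 2 <= a \/ a = 1 \/ a = 0 by lia.
- have [b2|[b1|b00]] : 2 <= b \/ b = 1 \/ b = 0 by lia.
  + trapped green_trap_dead (tri_rot (tri_rot (tri_swap T))).
    have h : 0 <= (a - 2) * (b * b - 1) by apply: Z.mul_nonneg_nonneg; nia.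
    by numeric.
  + subst b; have [c1|?] : 1 <= c \/ c = 0 by lia.
      trapped green_trap_dead (tri_rot (tri_rot (tri_swap T))).
      by numeric.
    subst c; trapped tree_belt_dead (tri_rot (tri_rot (tri_swap T))).
    exists a, 1; split; [lia | lia | do 4 right].
    by numeric.
  + subst b; trapped tree_belt_dead T.
    exists a, c; split; [lia | lia | do 2 right; left].
    by numeric.
- subst a; step T.
    (* After y, x: now x -> y, x -> z, and c arrows y -> z. *)
    have [c2|c1] : 2 <= c \/ c <= 1 by lia.
      step T; first by step T; [> explore T ..].
      trapped red_trap_dead (tri_rot (tri_swap T)).
      by numeric.
    by have [?|?] : c = 0 \/ c = 1; [lia | subst; explore T ..].
  (* After y, z: there are c + b arrows z -> x, and if b >= 1 this is a red trap
     as soon as c + b >= 2. *)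
  have [bc2|bc1] : (2 <= b \/ b = 1 /\ 1 <= c) \/ (b = 0 \/ b = 1 /\ c = 0) by lia.
    trapped red_trap_dead (tri_rot (tri_rot T)).
    by numeric.
  case: bc1 => [b1|[b1 c1]]; last by subst; explore T.
  subst b; have [c2|c1] : 2 <= c \/ c = 1 by lia.
    trapped tree_belt_dead (tri_swap T).
    exists c, 1; split; [lia | lia | left].
    by numeric.
  by subst c; explore T.
- subst a; step T; first by explore T.
  have [c2|c1] : 2 <= c \/ c = 1 by lia.
    trapped red_trap_dead (tri_rot (tri_rot T)).
    by numeric.
  by subst c; explore T.
Qed.

(** Mutating z gives z -> x, z -> y and x -> y: the belts start here, at once or
  after a few more mutations. *)
Lemma sink_first R x y z a b c u v w :
    triangle R x y z a b (- c) u v w -> 0 <= a -> 0 <= b -> 0 <= c ->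
    1 <= a + b -> 1 <= a + c -> 1 <= b + c ->
    (forall j, 0 <= u j) -> (forall j, 0 <= v j) -> (forall j, 0 <= w j) ->
  bounded 6 (mu z R).
Proof.
move=> T a0 b0 c0 ab ac bc u0 v0 w0.
have {}T := tri_rot (tri_mut_sink (tri_rot (tri_rot T)) ltac:(lia) b0 w0).
have [?|[?|[?|abc1]]] : a = 0 \/ b = 0 \/ c = 0 \/ (1 <= a /\ 1 <= b /\ 1 <= c)
  by lia.
- (* z is the source of a tree, with leaves x and y. *)
  subst a; have [b2|?] : 2 <= b \/ b = 1 by lia.
    have [c2|?] : 2 <= c \/ c = 1 by lia.
      trapped tree_belt_dead (tri_rot (tri_rot T)).
      exists c, b; split; [lia | lia | right; left].
      split; [lia | lia | lia | pointwise; nia | split; first by pointwise; nia].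
      by left; split; [lia | pointwise; nia].
    (* The products given to nonlinear arithmetic, here and below, compare a
       c-vector with its multiples. *)
    subst c; have h : forall j, 0 <= (b - 1) * (v j + b * w j).
      by pointwise; apply: Z.mul_nonneg_nonneg; nia.
    step T.
      step T.
        trapped tree_belt_dead (tri_rot (tri_swap T)).
        exists b, 1; split; [lia | lia | left].
        by numeric.
      trapped red_trap_dead T.
      by numeric.
    trapped tree_belt_dead (tri_rot (tri_swap T)).
    exists b, 1; split; [lia | lia | right; right; left].
    by numeric.
  subst b; have [?|c2] : c = 1 \/ 2 <= c by lia.
    by subst; explore T.
  have h : forall j, 0 <= (c - 1) * (u j + c * w j).
    by pointwise; apply: Z.mul_nonneg_nonneg; nia.
  step T.
    trapped tree_belt_dead (tri_rot (tri_rot T)).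
    exists c, 1; split; [lia | lia | right; right; left].
    by numeric.
  step T.
    trapped tree_belt_dead (tri_rot (tri_rot T)).
    exists c, 1; split; [lia | lia | left].
    by numeric.
  trapped red_trap_dead (tri_rot (tri_rot (tri_swap T))).
  by numeric.
- (* z -> x -> y is a path. *)
  subst b; have [c2|?] : 2 <= c \/ c = 1 by lia.
    trapped tree_belt_dead (tri_swap T).
    exists c, a; split; [lia | lia | right; right; left].
    by numeric.
  subst c; have [?|a2] : a = 1 \/ 2 <= a by lia.
    by subst; explore T.
  step T.
    step T; last by explore T.
    trapped red_trap_dead (tri_rot T).
    by numeric.
  trapped tree_belt_dead T.
  exists a, 1; split; [lia | lia | left].
  by numeric.
- (* y is the sink of a tree, with leaves x and z. *)
  subst c; have [a2|?] : 2 <= a \/ a = 1 by lia.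
    step T.
      have [?|b2] : b = 1 \/ 2 <= b by lia.
        by subst b; explore T.
      trapped red_trap_dead (tri_rot (tri_swap T)).
      by numeric.
    trapped tree_belt_dead (tri_rot (tri_rot (tri_swap T))).
    exists a, b; split; [lia | lia | right; left].
    have h1 : forall j, 0 <= (b - 1) * (v j + b * w j).
      by pointwise; apply: Z.mul_nonneg_nonneg; nia.
    split; [lia | lia | lia | pointwise; nia | split; first by pointwise; nia].
    have [b2|?] : 2 <= b \/ b = 1 by lia.
      have h : forall j, 0 <= (b - 2) * (v j + b * w j).
        by pointwise; apply: Z.mul_nonneg_nonneg; nia.
      by left; split; [lia | pointwise; nia].
    by right; split; [lia | pointwise; nia].
  subst a; have [?|b2] : b = 1 \/ 2 <= b by lia.
    by subst; explore T.
  step T.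
    trapped red_trap_dead (tri_rot (tri_swap T)).
    by numeric.
  have h1 : forall j, 0 <= (b - 1) * (v j + b * w j).
    by pointwise; apply: Z.mul_nonneg_nonneg; nia.
  have h2 : forall j, 0 <= (b - 2) * (b * (v j + b * w j) - w j).
    by pointwise; apply: Z.mul_nonneg_nonneg; nia.
  step T.
    step T.
      trapped red_trap_dead (tri_swap T).
      by numeric.
    trapped tree_belt_dead (tri_rot T).
    exists b, 1; split; [lia | lia | left].
    by numeric.
  trapped tree_belt_dead (tri_rot T).
  exists b, 1; split; [lia | lia | right; right; left].
  by numeric.
- (* z -> x -> y, z -> y is a belt if c >= 2, or else after mutating y. *)
  have [c2|?] : 2 <= c \/ c = 1 by lia.
    trapped belt_dead (tri_rot (tri_rot T)).
    split; [lia | lia | lia | pointwise; nia | split; first by pointwise; nia].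
    by left; split; [lia | pointwise; nia].
  subst c; step T.
    step T.
      trapped red_trap_dead (tri_rot T).
      by numeric.
    have [?|b2] : b = 1 \/ 2 <= b by lia.
      by subst b; explore T.
    trapped red_trap_dead T.
    by numeric.
  trapped belt_dead (tri_rot T).
  have h1 : forall j, 0 <= (a - 1) * (v j + b * w j).
    by pointwise; apply: Z.mul_nonneg_nonneg; nia.
  have h2 : forall j, 0 <= (b - 1) * (v j + b * w j).
    by pointwise; apply: Z.mul_nonneg_nonneg; nia.
  split; [lia | lia | lia | pointwise; nia | split; first by pointwise; nia].
  have [b2|?] : 2 <= b \/ b = 1 by lia.
    have h3 : forall j, 0 <= (b - 2) * (v j + b * w j).
      by pointwise; apply: Z.mul_nonneg_nonneg; nia.
    by left; split; [lia | pointwise; nia].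
  by right; split; [lia | pointwise; nia].
Qed.

Lemma bounded_acyclic R x y z a b c u v w :
    triangle R x y z a b (- c) u v w -> 0 <= a -> 0 <= b -> 0 <= c ->
    1 <= a + b -> 1 <= a + c -> 1 <= b + c ->
    (forall j, 0 <= u j) -> (forall j, 0 <= v j) -> (forall j, 0 <= w j) ->
  bounded 7 R.
Proof.
move=> T a0 b0 c0 ab ac bc u0 v0 w0; apply: (bounded_step T) => _.
- by apply: (@bounded_weaken 5) => //; apply: (source_first T) => //; lia.
- exact: (middle_first T).
- exact: (sink_first T).
Qed.

Lemma completes_sources R x y z a b c u v w :
    triangle R x y z a b (- c) u v w -> 0 <= a -> 0 <= b -> 0 <= c ->
    (forall j, 0 <= u j) -> (forall j, 0 <= v j) -> (forall j, 0 <= w j) ->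
  completes R [:: x; y; z].
Proof.
move=> T a0 b0 c0 u0 v0 w0.
have Ty := tri_rot (tri_mut_source T ltac:(lia) ltac:(lia) u0).
have Tz := tri_rot (tri_mut_source Ty ltac:(lia) ltac:(lia) v0).
have Tx := tri_rot (tri_mut_source Tz ltac:(lia) ltac:(lia) w0).
split; first exact/(tri_greenP T).
split; first exact/(tri_greenP Ty).
split; first exact/(tri_greenP Tz).
(* Each c-vector has changed its sign exactly once. *)
move=> i; have := tri_all T i; rewrite !inE => /or3P[] /eqP->.
- by apply/(tri_redP Tx) => j; have := u0 j; lia.
- by apply/(tri_redP (tri_rot Tx)) => j; have := v0 j; lia.
- by apply/(tri_redP (tri_rot (tri_rot Tx))) => j; have := w0 j; lia.
Qed.

(** * The framed quiver of an acyclic quiver *)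

Local Close Scope Z_scope.

Lemma finite_short_seqs (n : nat) : finite_set [set s : seq V | size s <= n].
Proof.
pose f (p : {m : 'I_n.+1 & m.-tuple V}) : seq V := tval (tagged p).
have : finite_set (range f) by apply/finite_image/finite_finset.
apply: sub_finite_set => s /= size_s.
by exists (Tagged (fun m : 'I_n.+1 => m.-tuple V)
  (in_tuple s : (Ordinal (size_s : size s < n.+1)).-tuple V)).
Qed.

Lemma acyclic_order (Q : quiver V) : #|V| = 3 -> acyclic Q ->
  exists x y z, [/\ uniq [:: x; y; z], forall k, k \in [:: x; y; z],
    Q y x = 0, Q z x = 0 & Q z y = 0].
Proof.
move=> V3 acQ; have [] : size (enum V) = 3 /\ uniq (enum V).
  by rewrite -cardT enum_uniq.
have := mem_enum V; case: (enum V) => [|p [|q [|r []]]] //= all _ uniqV.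
have order x y z : perm_eq [:: x; y; z] [:: p; q; r] ->
    [&& ~~ arrow Q y x, ~~ arrow Q z x & ~~ arrow Q z y] ->
  exists x y z, [/\ uniq [:: x; y; z], forall k, k \in [:: x; y; z],
    Q y x = 0, Q z x = 0 & Q z y = 0].
  rewrite /arrow -!eqn0Ngt => pe /and3P[/eqP ? /eqP ? /eqP ?]; exists x, y, z.
  by split=> //; [rewrite (perm_uniq pe) | move=> k; rewrite (perm_mem pe) all].
have pq := acQ [:: p; q] isT; have qr := acQ [:: q; r] isT.
have pr := acQ [:: p; r] isT.
have pqr := acQ [:: p; q; r] isT; have prq := acQ [:: p; r; q] isT.
have := order p q r; have := order p r q; have := order q p r.
have := order q r p; have := order r p q; have := order r q p.
move: pq qr pr pqr prq; rewrite /= !andbT.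
have perm s :
    (forall P, count P s = count P [:: p; q; r]) -> perm_eq s [:: p; q; r].
  by move=> ?; apply/permP.
rewrite !perm // => [|P|P|P|P|P] /=; rewrite -?plusE; try lia.
(* Of the orientations of the three edges, only the two cyclic ones are left
   without such an order, and they are excluded. *)
by do 6 case: (arrow Q _ _) => //=; auto.
Qed.

Lemma connected_neighbor (Q : quiver V) v k : connected_quiver Q -> k != v ->
  exists k', 0 < Q v k' + Q k' v.
Proof.
move=> [_ connQ] kv.
have /connectP[[|k' p] /= + eq_k] := connQ v k; first by rewrite eq_k eqxx in kv.
by case/andP=> vk' _; exists k'; rewrite addn_gt0.
Qed.

Lemma framed_net_frozen (Q : quiver V) i j :
  net (framed Q) (inl i) (inr j) = Z.of_nat (i == j).
Proof. by rewrite /net /= Z.sub_0_r. Qed.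

Local Open Scope Z_scope.

Lemma triangle_framed (Q : quiver V) x y z : cluster_quiver Q ->
    uniq [:: x; y; z] -> (forall k, k \in [:: x; y; z]) ->
    Q y x = 0%N -> Q z x = 0%N -> Q z y = 0%N ->
  triangle (framed Q) x y z
    (Z.of_nat (Q x y)) (Z.of_nat (Q y z)) (- Z.of_nat (Q x z))
    (fun j => Z.of_nat (x == j)) (fun j => Z.of_nat (y == j))
    (fun j => Z.of_nat (z == j)).
Proof.
move=> clQ uniq_xyz all yx zx zy; split=> //.
- by case: (framed_ice_quiver clQ).
- by rewrite /net /= yx Z.sub_0_r.
- by rewrite /net /= zy Z.sub_0_r.
- by rewrite /net /= zx.
- by move=> j; rewrite framed_net_frozen.
- by move=> j; rewrite framed_net_frozen.
- by move=> j; rewrite framed_net_frozen.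
move=> l m n eq0; move: uniq_xyz (eq0 x) (eq0 y) (eq0 z).
rewrite /= !inE negb_or andbT => /andP[/andP[xy xz] yz].
rewrite !eqxx ![_ == x]eq_sym [z == y]eq_sym (negPf xy) (negPf xz) (negPf yz) /=.
by split; lia.
Qed.

End Framed.

Theorem theorem5p4 (V : finType) (Q : quiver V)
  (V3 : #|V| = 3) (connQ : connected_quiver Q) (acycQ : acyclic Q) :
  finite_set (maximal_green_sequences Q) /\ maximal_green_sequences Q !=set0.
Proof.
have [x [y [z [uniq_xyz all yx zx zy]]]] := acyclic_order V3 acycQ.
have clQ := acyclic_cluster_quiver acycQ.
have Qkk k : Q k k = 0.
  by apply/eqP; rewrite -leqn0 leqNgt; case: clQ => noloop _; apply: noloop.
have T := triangle_framed clQ uniq_xyz all yx zx zy.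
have [[xy xz] yz] : (x != y /\ x != z) /\ y != z.
  by move: uniq_xyz; rewrite /= !inE negb_or andbT => /andP[/andP[]].
have [[kx kxP] [ky kyP] [kz kzP]] :
    [/\ exists k, 0 < Q x k + Q k x, exists k, 0 < Q y k + Q k y
      & exists k, 0 < Q z k + Q k z].
  split; [apply: (connected_neighbor (k := y)) | |] => //.
  - by rewrite eq_sym.
  - exact: (connected_neighbor (k := x)).
  - exact: (connected_neighbor (k := x)).
have ac : (1 <= Z.of_nat (Q x y) + Z.of_nat (Q x z))%Z.
  move: kxP; have := all kx; rewrite !inE.
  by case/or3P => /eqP->; rewrite ?Qkk ?yx ?zx ?addn0 // => /ltP; lia.
have ab : (1 <= Z.of_nat (Q x y) + Z.of_nat (Q y z))%Z.
  move: kyP; have := all ky; rewrite !inE.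
  by case/or3P => /eqP->; rewrite ?Qkk ?yx ?zy ?addn0 ?add0n // => /ltP; lia.
have bc : (1 <= Z.of_nat (Q y z) + Z.of_nat (Q x z))%Z.
  move: kzP; have := all kz; rewrite !inE.
  by case/or3P => /eqP->; rewrite ?Qkk ?zx ?zy ?addn0 ?add0n // => /ltP; lia.
split.
  apply: sub_finite_set (finite_short_seqs V 7) => s /maximal_green_sequenceP.
  by apply: (bounded_acyclic T); solve [lia | move=> j; lia].
exists [:: x; y; z]; apply/maximal_green_sequenceP.
by apply: (completes_sources T); solve [lia | move=> j; lia].
Qed.
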